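(* Let $K$ be a field and let $A$ be a $K$-algebra. If $X_1,\dots,X_n$ are algebraically independent over $A$ and $A$ contains a field extension of $K$ of transcendence degree $\geq n$ over $K$, then $$\dim\big(K(X_1,\dots,X_n)\otimes_K A\big)\ \geq\ n+\dim A.$$ Further, if $A$ is Noetherian, then $$\dim\big(K(X_1,\dots,X_n)\otimes_K A\big)=n+\dim A.$$
   Context: All rings and algebras are commutative with identity $\neq 0$. $\dim$ denotes Krull dimension (possibly $\infty$). That $X_1,\dots,X_n$ are algebraically independent over $A$ means that they are indeterminates over $A$; $K(X_1,\dots,X_n)$ is the field of rational functions over $K$ in these indeterminates. ''$A$ contains a field extension of $K$'' means that $A$ contains a $K$-subalgebra which is a field. *)

(* Defs.v *)
From HB Require Import structures.
From mathcomp Require Import all_boot all_order all_algebra.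
From mathcomp Require Import generic_quotient.
From mathcomp Require Import boolp classical_sets constructive_ereal.
(* The notations of mpoly clash with those of constructive_ereal. *)
From mathcomp Require mpoly.
Import -(notations) mpoly.

Set Implicit Arguments.
Unset Strict Implicit.
Unset Printing Implicit Defensive.

Import Order.TTheory GRing.Theory Num.Theory.
Local Open Scope classical_set_scope.
Local Open Scope quotient_scope.
Local Open Scope ring_scope.

Notation "{ 'mpoly' T [ n ] }" := (mpoly n T)
  (at level 0, T, n at level 2, format "{ 'mpoly'  T [ n ] }") : type_scope.

(* Suprema of sets of natural numbers are taken in \bar int, so that unbounded
   sets have supremum +oo and the empty set has supremum -oo. *)
Definition sup_nat (S : set nat) : \bar int :=
  supremum -oo%E [set (d%:Z)%:E%E | d in S].

Lemma sup_natP (S : set nat) :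
  supremums [set (d%:Z)%:E%E | d in S] (sup_nat S).
Proof.
rewrite /sup_nat /supremum; case: ifPn => [/eqP ->|/set0P[_ [d0 Sd0 _]]].
  by split=> // y _; rewrite leNye.
apply: xgetPex.
have [[N ubN]|unbounded] := pselect (exists N, forall d, S d -> (d <= N)%N).
  have exS : exists d, `[< S d >] by exists d0; apply/asboolP.
  have ubS d : `[< S d >] -> (d <= N)%N by move/asboolP/ubN.
  have [m /asboolP Sm maxm] := ex_maxnP exS ubS.
  exists (m%:Z)%:E%E; split=> [_ [d Sd <-]|y]; last by apply; exists m.
  by rewrite lee_fin lez_nat maxm //; apply/asboolP.
exists +oo%E; split=> [y _|y uby]; first exact: leey.
case: y uby => [z|//|] uby; last by have := uby _ (imageP _ Sd0).
case: unbounded; exists `|z|%N => d Sd.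
have := uby _ (imageP _ Sd).
by rewrite lee_fin => dz; rewrite -lez_nat (le_trans dz) // abszE ler_norm.
Qed.

Section KrullDimension.
Variable R : comPzRingType.

Definition ideal (I : set R) : Prop :=
  [/\ I 0, forall x y, I x -> I y -> I (x + y) & forall a x, I x -> I (a * x)].

Definition prime_ideal (P : set R) : Prop :=
  [/\ ideal P, ~ P 1 & forall x y, P (x * y) -> P x \/ P y].

Definition prime_chain (d : nat) (P : nat -> set R) : Prop :=
  (forall i, (i <= d)%N -> prime_ideal (P i)) /\
  (forall i, (i < d)%N -> P i `<` P i.+1).

Definition krull_dim : \bar int :=
  sup_nat [set d | exists P, prime_chain d P].

Definition noetherian : Prop :=
  forall I : set R, ideal I -> exists m (g : 'I_m -> R),
    I = [set x | exists c : 'I_m -> R, x = \sum_(i < m) c i * g i].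

End KrullDimension.

Section TranscendenceDegree.
Variables (K : fieldType) (A : comAlgType K).

Definition alg_independent (n : nat) (v : 'I_n -> A) : Prop :=
  forall p : {mpoly K[n]}, mmap (in_alg A) v p = 0 -> p = 0.

Definition subfield_over (F : {pred A}) : Prop :=
  GRing.subalg_closed F /\
  forall x, x \in F -> x != 0 -> exists2 y, y \in F & x * y = 1.

Definition trdeg (F : {pred A}) : \bar int :=
  sup_nat [set d | exists2 v : 'I_d -> A,
                     forall i, v i \in F & alg_independent v].

End TranscendenceDegree.

Section RationalFunctions.
Variables (K : fieldType) (n : nat).

Definition ratfun : Type := {fraction {mpoly K[n]}}.

HB.instance Definition _ := GRing.Field.on ratfun.

Definition ratfunC (k : K) : ratfun := FracField.tofrac (mpolyC n k).

Definition ratfun_scale (k : K) (f : ratfun) : ratfun := ratfunC k * f.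

Fact ratfun_scaleA a b f :
  ratfun_scale a (ratfun_scale b f) = ratfun_scale (a * b) f.
Proof. by rewrite /ratfun_scale /ratfunC !rmorphM mulrA. Qed.

Fact ratfun_scale1 : left_id 1 ratfun_scale.
Proof. by move=> f; rewrite /ratfun_scale /ratfunC !rmorph1 mul1r. Qed.

Fact ratfun_scaleDr : right_distributive ratfun_scale +%R.
Proof. by move=> a f g; rewrite /ratfun_scale mulrDr. Qed.

Fact ratfun_scaleDl f : {morph ratfun_scale^~ f : a b / a + b}.
Proof. by move=> a b; rewrite /ratfun_scale /ratfunC !rmorphD mulrDl. Qed.

HB.instance Definition _ := GRing.Zmodule_isLmodule.Build K ratfun
  ratfun_scaleA ratfun_scale1 ratfun_scaleDr ratfun_scaleDl.

Fact ratfun_scaleAl (k : K) (f g : ratfun) : k *: (f * g) = (k *: f) * g.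
Proof. exact: mulrA. Qed.

HB.instance Definition _ :=
  GRing.Lmodule_isLalgebra.Build K ratfun ratfun_scaleAl.
HB.instance Definition _ := GRing.Lalgebra_isComAlgebra.Build K ratfun.

End RationalFunctions.

Section TensorProduct.
Variables (K : comNzRingType) (B A : comAlgType K).

(* The sequence [:: (b1, a1); ...; (bm, am)] stands for the tensor
   b1 (x) a1 + ... + bm (x) am. *)
Local Notation presum := (seq (B * A)).

Inductive teq : presum -> presum -> Prop :=
| teq_refl s : teq s s
| teq_sym s t : teq s t -> teq t s
| teq_trans s t u : teq s t -> teq t u -> teq s u
| teq_cat s s' t t' : teq s s' -> teq t t' -> teq (s ++ t) (s' ++ t')
| teq_catC s t : teq (s ++ t) (t ++ s)
| teq_0l a : teq [:: (0, a)] [::]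
| teq_0r b : teq [:: (b, 0)] [::]
| teq_Dl b b' a : teq [:: (b + b', a)] [:: (b, a); (b', a)]
| teq_Dr b a a' : teq [:: (b, a + a')] [:: (b, a); (b, a')]
| teq_Z k b a : teq [:: (k *: b, a)] [:: (b, k *: a)].

Definition teqb (s t : presum) : bool := `[< teq s t >].

Fact teqb_refl : reflexive teqb.
Proof. by move=> s; apply/asboolP/teq_refl. Qed.

Fact teqb_sym : ssrbool.symmetric teqb.
Proof. by move=> s t; apply/asboolP/asboolP; apply: teq_sym. Qed.

Fact teqb_trans : transitive teqb.
Proof.
by move=> t s u /asboolP st /asboolP tu; apply/asboolP/(teq_trans st tu).
Qed.

Canonical teqb_equiv := EquivRel teqb teqb_refl teqb_sym teqb_trans.

Definition tensor : Type := {eq_quot teqb}.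

HB.instance Definition _ := Choice.on tensor.
HB.instance Definition _ : EqQuotient _ teqb tensor := EqQuotient.on tensor.

Definition presum_opp (s : presum) : presum := [seq (- p.1, p.2) | p <- s].

Definition presum_mul (s t : presum) : presum :=
  [seq (p.1 * q.1, p.2 * q.2) | p <- s, q <- t].

Lemma teqP s t : reflect (\pi_tensor s = \pi_tensor t) (teqb s t).
Proof.
by rewrite -[teqb s t](eqmodE (teqb_equiv : equiv_rel _)); apply: eqP.
Qed.

Lemma tensor_eq s t : teq s t -> \pi_tensor s = \pi_tensor t.
Proof. by move=> st; apply/teqP/asboolP. Qed.

Lemma teq_repr s : teq (repr (\pi_tensor s)) s.
Proof. by apply/asboolP/teqP; rewrite reprK. Qed.

Lemma teq_catl s t t' : teq t t' -> teq (s ++ t) (s ++ t').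
Proof. exact/teq_cat/teq_refl. Qed.

Lemma teq_catACA s t u v : teq ((s ++ t) ++ (u ++ v)) ((s ++ u) ++ (t ++ v)).
Proof.
rewrite -!catA; apply: teq_catl; rewrite !catA.
by apply: teq_cat; [apply: teq_catC|apply: teq_refl].
Qed.

Lemma teq_map2 (T : Type) (f g h : T -> B * A) :
    (forall x, teq [:: f x] [:: g x; h x]) ->
  forall s, teq (map f s) (map g s ++ map h s).
Proof.
move=> fgh; elim=> [|x s IHs]; first exact: teq_refl.
apply: teq_trans (teq_cat (fgh x) IHs) _.
exact: (teq_catACA [:: g x] [:: h x]).
Qed.

Lemma teq_map (T : Type) (f g : T -> B * A) :
    (forall x, teq [:: f x] [:: g x]) -> forall s, teq (map f s) (map g s).
Proof.
move=> fg; elim=> [|x s IHs]; first exact: teq_refl.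
exact: (teq_cat (fg x) IHs).
Qed.

Lemma teq_map0 (T : Type) (f : T -> B * A) :
  (forall x, teq [:: f x] [::]) -> forall s, teq (map f s) [::].
Proof.
move=> f0; elim=> [|x s IHs]; first exact: teq_refl.
exact: (teq_cat (f0 x) IHs).
Qed.

Lemma teq_opp s t : teq s t -> teq (presum_opp s) (presum_opp t).
Proof.
rewrite /presum_opp; elim=> {s t} /=.
- by move=> s; apply: teq_refl.
- by move=> s t _; apply: teq_sym.
- by move=> s t u _ st _; apply: teq_trans.
- by move=> s s' t t' _ ss' _ tt'; rewrite !map_cat; apply: teq_cat.
- by move=> s t; rewrite !map_cat; apply: teq_catC.
- by move=> a; rewrite oppr0; apply: teq_0l.
- by move=> b; apply: teq_0r.
- by move=> b b' a; rewrite opprD; apply: teq_Dl.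
- by move=> b a a'; apply: teq_Dr.
- by move=> k b a; rewrite -scalerN; apply: teq_Z.
Qed.

Lemma presum_mul1 p t :
  presum_mul [:: p] t = [seq (p.1 * q.1, p.2 * q.2) | q <- t].
Proof. by rewrite /presum_mul /= cats0. Qed.

Lemma presum_mul_catl s t u :
  presum_mul (s ++ t) u = presum_mul s u ++ presum_mul t u.
Proof. exact: allpairs_cat. Qed.

Lemma presum_mul2 p q t :
  presum_mul [:: p; q] t = presum_mul [:: p] t ++ presum_mul [:: q] t.
Proof. exact: (presum_mul_catl [:: p] [:: q]). Qed.

Lemma teq_mull u s t : teq s t -> teq (presum_mul s u) (presum_mul t u).
Proof.
elim=> {s t} /=.
- by move=> s; apply: teq_refl.
- by move=> s t _; apply: teq_sym.
- by move=> s t v _ st _; apply: teq_trans.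
- by move=> s s' t t' _ ss' _ tt'; rewrite !presum_mul_catl; apply: teq_cat.
- by move=> s t; rewrite !presum_mul_catl; apply: teq_catC.
- move=> a; rewrite presum_mul1; apply: teq_map0 => q /=.
  by rewrite mul0r; apply: teq_0l.
- move=> b; rewrite presum_mul1; apply: teq_map0 => q /=.
  by rewrite mul0r; apply: teq_0r.
- move=> b b' a; rewrite presum_mul2 !presum_mul1; apply: teq_map2 => q /=.
  by rewrite mulrDl; apply: teq_Dl.
- move=> b a a'; rewrite presum_mul2 !presum_mul1; apply: teq_map2 => q /=.
  by rewrite mulrDl; apply: teq_Dr.
- move=> k b a; rewrite !presum_mul1; apply: teq_map => q /=.
  by rewrite -!scalerAl; apply: teq_Z.
Qed.

Lemma teq_perm s t : perm_eq s t -> teq s t.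
Proof.
move=> st; apply: (catCA_perm_ind _ st (P := teq s)); last exact: teq_refl.
move=> u v w /teq_trans; apply; rewrite !catA.
by apply: teq_cat; [apply: teq_catC|apply: teq_refl].
Qed.

Lemma teq_mulC s t : teq (presum_mul s t) (presum_mul t s).
Proof.
apply: teq_perm; rewrite /presum_mul; elim: s => [|p s IHs] /=.
  by elim: t.
rewrite perm_sym; apply: (perm_trans (y := [seq (q.1 * p.1, q.2 * p.2) | q <- t]
    ++ [seq (q.1 * r.1, q.2 * r.2) | q <- t, r <- s])).
  exact/permPl/(perm_allpairs_consr _ t (fun=> p) (fun=> s)).
apply: perm_cat; last by rewrite perm_sym.
rewrite (@eq_map _ _ _ (fun q => (p.1 * q.1, p.2 * q.2))) // => q.
by rewrite (mulrC p.1) (mulrC p.2).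
Qed.

Definition tensor_zero : tensor := \pi_tensor [::].
Definition tensor_add (x y : tensor) : tensor :=
  \pi_tensor (repr x ++ repr y).
Definition tensor_opp (x : tensor) : tensor :=
  \pi_tensor (presum_opp (repr x)).
Definition tensor_one : tensor := \pi_tensor [:: (1, 1)].
Definition tensor_mul (x y : tensor) : tensor :=
  \pi_tensor (presum_mul (repr x) (repr y)).

Lemma pi_tensor_add s t :
  tensor_add (\pi s) (\pi t) = \pi_tensor (s ++ t).
Proof. by apply/tensor_eq/teq_cat; apply: teq_repr. Qed.

Lemma pi_tensor_opp s : tensor_opp (\pi s) = \pi_tensor (presum_opp s).
Proof. exact/tensor_eq/teq_opp/teq_repr. Qed.

Lemma pi_tensor_mul s t :
  tensor_mul (\pi s) (\pi t) = \pi_tensor (presum_mul s t).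
Proof.
apply/tensor_eq; apply: teq_trans (teq_mull _ (teq_repr s)) _.
apply: teq_trans (teq_mulC _ _) _.
by apply: teq_trans (teq_mull _ (teq_repr t)) _; apply: teq_mulC.
Qed.

Fact tensor_addA : associative tensor_add.
Proof.
elim/quotW=> s; elim/quotW=> t; elim/quotW=> u.
by rewrite !pi_tensor_add catA.
Qed.

Fact tensor_addC : commutative tensor_add.
Proof.
elim/quotW=> s; elim/quotW=> t; rewrite !pi_tensor_add.
exact/tensor_eq/teq_catC.
Qed.

Fact tensor_add0 : left_id tensor_zero tensor_add.
Proof. by elim/quotW=> s; rewrite pi_tensor_add. Qed.

Fact tensor_addN : left_inverse tensor_zero tensor_opp tensor_add.
Proof.
elim/quotW=> s; rewrite pi_tensor_opp pi_tensor_add; apply/tensor_eq.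
rewrite -[X in _ ++ X]map_id; apply: teq_trans.
  apply/teq_sym/(@teq_map2 _ (fun p => (- p.1 + p.1, p.2))) => -[b a] /=.
  exact: teq_Dl.
by apply: teq_map0 => p; rewrite addNr; apply: teq_0l.
Qed.

HB.instance Definition _ := GRing.isZmodule.Build tensor
  tensor_addA tensor_addC tensor_add0 tensor_addN.

Fact presum_mulA : associative presum_mul.
Proof.
move=> s t u; elim: s => //= p s IHs.
rewrite -cat1s 2!presum_mul_catl presum_mul_catl -IHs; congr (_ ++ _).
rewrite !presum_mul1; elim: t {s IHs} => //= q t IHt.
rewrite -(cat1s q t) presum_mul_catl map_cat IHt.
rewrite -[_ :: map _ t]cat1s presum_mul_catl !presum_mul1 -map_comp.
by congr (_ ++ _); apply: eq_map => r /=; rewrite !mulrA.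
Qed.

Fact tensor_mulA : associative tensor_mul.
Proof.
elim/quotW=> s; elim/quotW=> t; elim/quotW=> u.
by rewrite !pi_tensor_mul presum_mulA.
Qed.

Fact tensor_mulC : commutative tensor_mul.
Proof.
elim/quotW=> s; elim/quotW=> t; rewrite !pi_tensor_mul.
exact/tensor_eq/teq_mulC.
Qed.

Fact tensor_mul1 : left_id tensor_one tensor_mul.
Proof.
elim/quotW=> s; rewrite pi_tensor_mul presum_mul1.
by congr (\pi _); elim: s => //= -[b a] s ->; rewrite !mul1r.
Qed.

Fact tensor_mulDl : left_distributive tensor_mul tensor_add.
Proof.
elim/quotW=> s; elim/quotW=> t; elim/quotW=> u.
by rewrite !(pi_tensor_mul, pi_tensor_add) presum_mul_catl.
Qed.

HB.instance Definition _ := GRing.Zmodule_isComPzRing.Build tensor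
  tensor_mulA tensor_mulC tensor_mul1 tensor_mulDl.

Definition pure_tensor (b : B) (a : A) : tensor := \pi_tensor [:: (b, a)].

End TensorProduct.

Arguments tensor K B A : clear implicits.

(* Main.v *)
Require Import Defs.
From HB Require Import structures.
From mathcomp Require Import all_boot all_order all_algebra.
From mathcomp Require Import generic_quotient ring_quotient.
From mathcomp Require Import boolp classical_sets constructive_ereal.
From mathcomp Require Import ring.
From mathcomp Require mpoly.
Import -(notations) mpoly.

(* Write T for K(X_1, ..., X_n) (x) A, a localization of A[X_1, ..., X_n] at the
   nonzero polynomials over K.

   Lower bound: let P_0 < ... < P_d be a chain of primes of A, let t_1, ..., t_n
   be algebraically independent elements of the subfield, and let L be the
   residue field of P_d. The primes P_i[X_1, ..., X_n], followed by the kernels of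
   A[X_1, ..., X_n] -> L[X_1, ..., X_n] sending X_i to t_i for i <= j and to X_i
   for i > j, where j = 1, ..., n, form a chain of length d + n. The last
   kernel contains no nonzero polynomial over K, because the subfield embeds into
   L and the t_i are algebraically independent. Hence the whole chain extends to T.

   Upper bound: by contraction and induction on n it suffices to bound the length
   of chains of primes Q_0 < ... < Q_r of R[X] for R noetherian. If r >= 2 then
   Q_r and Q_0 have distinct contractions to R, so Q_r contains some a in R that
   is not in Q_0. By Krull's principal ideal theorem the intermediate primes can be
   chosen so that a lies in Q_1. Then Q_0 and Q_1 have distinct contractions to R,
   and induction on r gives a chain of length r - 1 in R. *)

Set Implicit Arguments.
Unset Strict Implicit.
Unset Printing Implicit Defensive.

Import Order.TTheory GRing.Theory Num.Theory.
Local Open Scope classical_set_scope.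
Local Open Scope ring_scope.

Local Notation polyvar R i := (@mpoly.mpolyX _ R (mnm1 i)).

(** * Noetherian rings and the principal ideal theorem *)

Section Ideals.
Variable R : comPzRingType.
Implicit Types (I J P : set R) (a x y z : R).

Lemma ideal0 I : ideal I -> I 0. Proof. by case. Qed.

Lemma idealD I x y : ideal I -> I x -> I y -> I (x + y).
Proof. by case=> _ ID _; apply: ID. Qed.

Lemma idealM I a x : ideal I -> I x -> I (a * x).
Proof. by case=> _ _; apply. Qed.

Lemma idealB I x y : ideal I -> I x -> I y -> I (x - y).
Proof.
by move=> idI Ix Iy; apply: idealD => //; rewrite -mulN1r; apply: idealM.
Qed.

Lemma prime_idealP P : prime_ideal P -> ideal P. Proof. by case. Qed.

Lemma prime_mem P x y : prime_ideal P -> P (x * y) -> ~ P x -> P y.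
Proof. by case=> _ _ PM /PM[]. Qed.

Lemma prime_notM P x y : prime_ideal P -> ~ P x -> ~ P y -> ~ P (x * y).
Proof. by move=> pP nx ny /(prime_mem pP)/(_ nx). Qed.

Lemma prime_notX P x n : prime_ideal P -> ~ P x -> ~ P (x ^+ n).
Proof.
move=> pP nx; elim: n => [|n IHn]; first by rewrite expr0; case: pP.
by rewrite exprS; apply: prime_notM.
Qed.

Definition ideal_adjoin I a : set R := [set z | exists t, I (z - t * a)].

Lemma ideal_adjoinP I a : ideal I -> ideal (ideal_adjoin I a).
Proof.
move=> idI; split.
- by exists 0; rewrite mul0r subrr; apply: ideal0.
- move=> x y [t Ix] [u Iy]; exists (t + u).
  have -> : x + y - (t + u) * a = (x - t * a) + (y - u * a) by ring.
  exact: idealD.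
- move=> b x [t Ix]; exists (b * t).
  have -> : b * x - b * t * a = b * (x - t * a) by ring.
  exact: idealM.
Qed.

Lemma sub_ideal_adjoin I a : I `<=` ideal_adjoin I a.
Proof. by move=> x Ix; exists 0; rewrite mul0r subr0. Qed.

Lemma mem_ideal_adjoin I a : ideal I -> ideal_adjoin I a a.
Proof. by move=> idI; exists 1; rewrite mul1r subrr; apply: ideal0. Qed.

Definition ideal_colon I a : set R := [set z | I (z * a)].

Lemma ideal_colonP I a : ideal I -> ideal (ideal_colon I a).
Proof.
move=> idI; split; rewrite /ideal_colon /=.
- by rewrite mul0r; apply: ideal0.
- by move=> x y Ix Iy; rewrite mulrDl; apply: idealD.
- by move=> b x Ix; rewrite -mulrA; apply: idealM.
Qed.

Lemma sub_ideal_colon I a : ideal I -> I `<=` ideal_colon I a.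
Proof. by move=> idI x Ix; rewrite /ideal_colon /= mulrC; apply: idealM. Qed.

(** Generation by [s] is expressed through the ideals containing [s], so linear combinations never
    have to be written out. *)
Definition fin_gen I := exists s : seq R, (forall x, x \in s -> I x) /\
  forall J, ideal J -> (forall x, x \in s -> J x) -> I `<=` J.

Definition all_fin_gen := forall I, ideal I -> fin_gen I.

Lemma noetherian_fin_gen : noetherian R -> all_fin_gen.
Proof.
move=> noeR I idI; have [m [g ->]] := noeR I idI.
exists [seq g i | i <- enum 'I_m]; split=> [_ /mapP[i _ ->]|J idJ Jg _ [c ->]].
  exists (fun j => (j == i)%:R); rewrite (bigD1 i) //= eqxx mul1r big1 ?addr0 //.
  by move=> j /negPf ->; rewrite mul0r.
elim/big_ind: _ => [|x y|i _]; first exact: ideal0; first exact: idealD.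
by apply: idealM => //; apply/Jg/map_f; rewrite mem_enum.
Qed.

(** The union of a chain in [C] is an ideal whose finitely many generators already lie in one
    member, so it equals that member and Zorn's lemma applies. *)
Lemma noetherian_maximal (C : set (set R)) I0 :
    all_fin_gen -> (forall I, C I -> ideal I) -> C I0 ->
  exists I, C I /\ forall J, C J -> I `<=` J -> J `<=` I.
Proof.
move=> noeR idC CI0.
have [|I [CI maxI]] := @Zorn_bigcup R [set I | C I \/ I = set0]; last first.
  case: CI => [CI|I_0]; last first.
    case: (maxI I0); last by left.
    by rewrite I_0; split=> // /(_ 0 (ideal0 (idC _ CI0))).
  exists I; split=> // J CJ IJ; apply: contrapT => nJI.
  by apply: (maxI J); [split|left].
move=> F FC totF.
have [F0|/existsNP[X1 /not_implyP[FX1 CX1]]] := pselect (forall X, F X -> ~ C X).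
  right; rewrite -subset0 => x [X FX Xx].
  by have [/(F0 X FX)//|X0] := FC _ FX; rewrite X0 in Xx.
move: CX1 => /contrapT CX1; left.
have Fid X x : F X -> X x -> C X.
  by move=> /FC[//|->].
have idU : ideal (\bigcup_(X in F) X).
  split.
  - by exists X1 => //; apply: ideal0 (idC _ CX1).
  - move=> x y [X FX Xx] [Y FY Yy]; have [XY|YX] := totF _ _ FX FY.
      by exists Y => //; apply: idealD => //; [apply/idC/(Fid _ y)|apply: XY].
    by exists X => //; apply: idealD => //; [apply/idC/(Fid _ x)|apply: YX].
  - move=> a x [X FX Xx]; exists X => //.
    by apply: idealM => //; apply/idC/(Fid _ x).
have [s [sU genU]] := noeR _ idU.
have [X [FX CX Xs]] : exists X, [/\ F X, C X & forall x, x \in s -> X x].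
  elim: s sU {genU} => [|x s IHs] sU; first by exists X1.
  have [y ys|X [FX CX Xs]] := IHs; first by apply: sU; rewrite inE ys orbT.
  have [|Y FY Yx] := sU x; first by rewrite inE eqxx.
  have [XY|YX] := totF _ _ FX FY.
    exists Y; split=> //; first exact: Fid Yx.
    by move=> z; rewrite inE => /predU1P[->//|/Xs/XY].
  exists X; split=> // z; rewrite inE => /predU1P[->|/Xs //]; exact: YX.
suff -> : \bigcup_(X in F) X = X by [].
apply/seteqP; split; last by move=> x Xx; exists X.
exact: genU (idC _ CX) Xs.
Qed.

End Ideals.

Section PrincipalIdealTheorem.
Variable R : comPzRingType.
Implicit Types (I J N M P : set R) (x y z : R).

(* The image of I in the localization of R at P lies in that of J. *)
Definition loc_sub P I J := forall z, I z -> exists s, ~ P s /\ J (s * z).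

(** For P prime this says that the localization of R / I at P is Artinian. *)
Definition loc_dcc P I := forall J : nat -> set R,
  (forall k, ideal (J k)) -> (forall k, J k.+1 `<=` J k) ->
  (forall k, I `<=` J k) ->
  exists k0, forall k, (k0 <= k)%N -> loc_sub P (J k) (J k.+1).

Lemma loc_subW P I J : prime_ideal P -> I `<=` J -> loc_sub P I J.
Proof. by case=> _ P1 _ IJ z /IJ Jz; exists 1; rewrite mul1r. Qed.

Lemma loc_sub_unit P I J : ideal J -> ~ J `<=` P -> loc_sub P I J.
Proof.
move=> idJ /existsNP[s /not_implyP[Js Ps]] z _; exists s; split=> //.
by rewrite mulrC; apply: idealM.
Qed.

(* Noetherian induction: if ab lies in I, then a chain above I is controlled by
   the chains obtained from it by adjoining a and by taking the colon by a. *)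
Lemma minimal_prime_loc_dcc P I :
    all_fin_gen R -> prime_ideal P -> ideal I ->
    (forall Q, prime_ideal Q -> I `<=` Q -> Q `<=` P -> P `<=` Q) ->
  loc_dcc P I.
Proof.
move=> noeR pP idI minP; apply: contrapT => ndccI.
have [|||I1 [[idI1 II1 ndcc1] maxI1]] :=
  @noetherian_maximal R [set J | [/\ ideal J, I `<=` J & ~ loc_dcc P J]] I.
- by [].
- by move=> J [].
- by split.
have larger J : ideal J -> I1 `<=` J -> ~ J `<=` I1 -> loc_dcc P J.
  move=> idJ I1J nJ; apply: contrapT => ndJ; apply: nJ; apply: maxI1 => //.
  by split=> //; apply: subset_trans I1J.
have I1P : I1 `<=` P.
  apply: contrapT => nI1P; apply: ndcc1 => J idJ decJ I1J; exists 0%N => k _.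
  by apply: loc_sub_unit => // JP; apply: nI1P; apply: subset_trans JP.
have pI1 : prime_ideal I1.
  split=> //; first by move/I1P; case: pP.
  move=> a b I1ab; apply: contrapT => /not_orP[nIa nIb]; apply: ndcc1.
  move=> J idJ decJ I1J.
  have dccD : loc_dcc P (ideal_adjoin I1 a).
    apply: larger; [exact: ideal_adjoinP|exact: sub_ideal_adjoin|].
    by move=> /(_ a) h; apply/nIa/h/mem_ideal_adjoin.
  have dccC : loc_dcc P (ideal_colon I1 a).
    apply: larger; [exact: ideal_colonP|exact: sub_ideal_colon|].
    by move=> /(_ b) h; apply/nIb/h; rewrite /ideal_colon /= mulrC.
  have [| | |k1 stab1] := dccD (fun k => ideal_adjoin (J k) a).
  - by move=> k; apply: ideal_adjoinP.
  - by move=> k z [t Jz]; exists t; apply: decJ.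
  - by move=> k z [t Jz]; exists t; apply: I1J.
  have [| | |k2 stab2] := dccC (fun k => ideal_colon (J k) a).
  - by move=> k; apply: ideal_colonP.
  - by move=> k z; apply: decJ.
  - by move=> k z; apply: I1J.
  exists (maxn k1 k2) => k; rewrite geq_max => /andP[k1k k2k] z Jz.
  (* Stability after adjoining [a] makes [s * z] congruent to [t * a] modulo [J k.+1], so [t * a] is
     in [J k]; stability of the colon ideals then moves [u * t * a] into [J k.+1]. *)
  have [s [Ps [t Jt]]] := stab1 k k1k z (sub_ideal_adjoin a Jz).
  have Jta : J k (t * a).
    have -> : t * a = s * z - (s * z - t * a) by ring.
    by apply: idealB => //; [apply: idealM|apply: decJ].
  have [u [Pu Ju]] := stab2 k k2k t Jta.
  exists (u * s); split; first exact: prime_notM.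
  have -> : u * s * z = u * (s * z - t * a) + u * t * a by ring.
  by apply: idealD => //; apply: idealM.
(* Now [I1] is a prime between [I] and [P], hence equal to [P] by minimality. A chain above it
   either never enters [P], and is locally the unit ideal, or is eventually caught between [I1] and
   [P]. *)
apply: ndcc1 => J idJ decJ I1J.
have [allJ|/existsNP[k0 nJk0]] := pselect (forall k, ~ J k `<=` P).
  by exists 0%N => k _; apply: loc_sub_unit.
move: nJk0 => /contrapT Jk0P; exists k0 => k k0k; apply: loc_subW => //.
have decJk : J k `<=` J k0.
  move: k0k => /subnK <-; elim: (k - k0)%N => // m IHm; rewrite addSn.
  exact: subset_trans (decJ _) IHm.
apply: subset_trans (I1J k.+1); apply: subset_trans (minP _ pI1 II1 I1P).
exact: subset_trans Jk0P.
Qed.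

(** The last hypothesis reads N = M + xN locally at P. If the conclusion fails, take [N1] maximal
    among the ideals between M and N for which it fails. Modulo [N1], N is locally generated by one
    element [g], which is killed by [s * u - x * t], a unit at P. *)
Lemma loc_nakayama P N M x :
    all_fin_gen R -> prime_ideal P -> P x -> ideal N -> ideal M -> M `<=` N ->
    (forall z, N z -> exists s, ~ P s /\ exists2 w, N w & M (s * z - w * x)) ->
  loc_sub P N M.
Proof.
move=> noeR pP Px idN idM MN NMx; apply: contrapT => nNM.
have [|||N1 [[idN1 MN1 N1N nNN1] maxN1]] := @noetherian_maximal R
  [set J | [/\ ideal J, M `<=` J, J `<=` N & ~ loc_sub P N J]] M.
- by [].
- by move=> J [].
- by split.
have /existsNP[g /not_implyP[Ng nN1g]] : ~ N `<=` N1.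
  by move=> NN1; apply: nNN1; apply: loc_subW.
have NN1g : loc_sub P N (ideal_adjoin N1 g).
  apply: contrapT => nloc; apply: nN1g.
  apply: (maxN1 (ideal_adjoin N1 g)); last exact: mem_ideal_adjoin.
    split=> //; first exact: ideal_adjoinP.
      by apply: subset_trans MN1 _; apply: sub_ideal_adjoin.
    move=> z [t N1z]; rewrite -(subrK (t * g) z).
    by apply: idealD => //; [apply: N1N|apply: idealM].
  exact: sub_ideal_adjoin.
have [s [Ps [w Nw Mw]]] := NMx g Ng.
have [u [Pu [t N1t]]] := NN1g w Nw.
have N1r : N1 ((s * u - x * t) * g).
  have -> : (s * u - x * t) * g = u * (s * g - w * x) + x * (u * w - t * g).
    by ring.
  by apply: idealD => //; apply: idealM => //; apply: MN1.
have nPr : ~ P (s * u - x * t).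
  move=> Pr; apply: (prime_notM pP Ps Pu).
  rewrite -(subrK (x * t) (s * u)); apply: idealD => //.
  - by case: pP.
  - by rewrite mulrC; apply: idealM => //; case: pP.
apply: nNN1 => z Nz; have [v [Pv [c N1c]]] := NN1g z Nz.
exists ((s * u - x * t) * v); split; first exact: prime_notM.
set r := s * u - x * t in N1r nPr *.
have -> : r * v * z = r * (v * z - c * g) + c * (r * g) by ring.
by apply: idealD => //; apply: idealM.
Qed.

(* If the conclusion fails, P2 is minimal over P0 + (x). The ideals q n are the symbolic powers
   of (y) at P1 modulo P0; the descending chain condition makes q n equal to
   q n.+1 + x q n at P2 for some n, hence to q n.+1 by Nakayama's lemma. This is
   impossible because y is nonzero in the domain R / P0. *)
Lemma principal_ideal_theorem (P0 P1 P2 : set R) x :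
    all_fin_gen R -> prime_ideal P0 -> prime_ideal P1 -> prime_ideal P2 ->
    P0 `<` P1 -> P1 `<` P2 -> P2 x ->
  exists Q, [/\ prime_ideal Q, P0 `<` Q, Q `<` P2 & Q x].
Proof.
move=> noeR p0 p1 p2 [P01 nP10] [P12 nP21] P2x.
have [P1x|nP1x] := pselect (P1 x); first by exists P1.
apply: contrapT => nQ.
have i0 : ideal P0 by case: p0.
have i1 : ideal P1 by case: p1.
(* Such a [Q] contains [x], while [P0] does not, being inside [P1]; by [nQ] it cannot lie strictly
   inside [P2]. *)
have minP2 Q : prime_ideal Q -> ideal_adjoin P0 x `<=` Q -> Q `<=` P2 ->
    P2 `<=` Q.
  move=> pQ P0xQ QP2; apply: contrapT => nP2Q; apply: nQ; exists Q.
  have Qx : Q x by apply/P0xQ/mem_ideal_adjoin.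
  split=> //; split; first by apply: subset_trans P0xQ; apply: sub_ideal_adjoin.
  by move=> /(_ x Qx)/P01.
have [y P1y nP0y] : exists2 y, P1 y & ~ P0 y.
  by move/existsNP: nP10 => [y /not_implyP[]]; exists y.
pose q n : set R := [set z | exists s, ~ P1 s /\ exists c, P0 (s * z - c * y ^+ n)].
have idq n : ideal (q n).
  split.
  - exists 1; split; first by case: p1.
    by exists 0; rewrite mulr0 mul0r subrr; apply: ideal0.
  - move=> z w [s [s1 [c Pc]]] [t [t1 [d Pd]]].
    exists (s * t); split; first exact: prime_notM.
    exists (t * c + s * d).
    have -> : s * t * (z + w) - (t * c + s * d) * y ^+ n =
      t * (s * z - c * y ^+ n) + s * (t * w - d * y ^+ n) by ring.
    by apply: idealD => //; apply: idealM.
  - move=> a z [s [s1 [c Pc]]]; exists s; split=> //; exists (a * c).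
    have -> : s * (a * z) - a * c * y ^+ n = a * (s * z - c * y ^+ n) by ring.
    exact: idealM.
have decq n : q n.+1 `<=` q n.
  move=> z [s [s1 [c Pc]]]; exists s; split=> //; exists (c * y).
  by rewrite -mulrA -exprS.
have P0q n : P0 `<=` q n.
  move=> z P0z; exists 1; split; first by case: p1.
  by exists 0; rewrite mul1r mul0r subr0.
have [| | |k stab] := minimal_prime_loc_dcc noeR p2 (ideal_adjoinP x i0) minP2
    (J := fun k => ideal_adjoin (q k) x).
- by move=> k; apply: ideal_adjoinP.
- by move=> k z [t qz]; exists t; apply: decq.
- by move=> k z [t P0z]; exists t; apply: P0q.
have {}stab := stab k (leqnn k).
have /(_ (y ^+ k))[] : loc_sub P2 (q k) (q k.+1).
- apply: (loc_nakayama noeR p2 P2x) => // z qz.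
  have [s [P2s [t qt]]] := stab z (sub_ideal_adjoin x qz).
  exists s; split=> //; exists t => //.
  (* Since [x] is outside [P1], membership of [t * x] in [q k] gives that of [t], as Nakayama's
     lemma requires. *)
  have [u [P1u [c P0c]]] : q k (t * x).
    have -> : t * x = s * z - (s * z - t * x) by ring.
    by apply: idealB => //; [apply: idealM|apply: decq].
  exists (u * x); split; first exact: prime_notM.
  by exists c; rewrite -mulrA [x * t]mulrC.
- exists 1; split; first by case: p1.
  by exists 1; rewrite mul1r subrr; apply: ideal0.
move=> s [P2s [u [P1u [c P0c]]]].
(* Cancelling [y ^+ k] modulo [P0] leaves [u * s - c * y] in [P0], so [u * s] is in [P1] although
   neither factor is. *)
have : P0 (y ^+ k * (u * s - c * y)).
  have <- : u * (s * y ^+ k) - c * y ^+ k.+1 = y ^+ k * (u * s - c * y) => //.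
  by rewrite exprS; ring.
move/(prime_mem p0)/(_ (prime_notX p0 nP0y))/P01 => P1r.
have nP1s : ~ P1 s by move/P12.
apply: (prime_notM p1 P1u nP1s); rewrite -(subrK (c * y) (u * s)).
by apply: idealD => //; apply: idealM.
Qed.

End PrincipalIdealTheorem.

(** * Chains of primes in polynomial rings *)

Section Preimages.
Variables (R S : comPzRingType) (f : {rmorphism R -> S}).

Lemma ideal_preimage (I : set S) : ideal I -> ideal (f @^-1` I).
Proof.
move=> idI; split=> /= [|x y Ix Iy|a x Ix]; first by rewrite rmorph0; apply: ideal0.
  by rewrite rmorphD; apply: idealD.
by rewrite rmorphM; apply: idealM.
Qed.

Lemma prime_preimage (P : set S) : prime_ideal P -> prime_ideal (f @^-1` P).
Proof.
case=> idP P1 PM; split; first exact: ideal_preimage.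
  by rewrite /= rmorph1.
by move=> x y /=; rewrite rmorphM => /PM.
Qed.

Lemma all_fin_gen_surj : (forall y, exists x, f x = y) ->
  all_fin_gen R -> all_fin_gen S.
Proof.
move=> surj noeR I idI; have [s [sI gens]] := noeR _ (ideal_preimage idI).
exists (map f s); split=> [_ /mapP[x /sI Ix ->] //|J idJ sJ y Iy].
have [x fx] := surj y.
rewrite -fx; apply: (gens (f @^-1` J)) => [|z zs|]; first exact: ideal_preimage.
  exact/sJ/map_f.
by rewrite /= fx.
Qed.

End Preimages.

Section Chains.
Variable R : comPzRingType.
Implicit Types (F G : nat -> set R) (P : set R).

Definition chain_cons P F : nat -> set R := fun i => if i is j.+1 then F j else P.

Lemma prime_chain0 P : prime_ideal P -> prime_chain 0 (fun=> P).
Proof. by []. Qed.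

Lemma prime_chain_cons d P F :
    prime_ideal P -> P `<` F 0%N -> prime_chain d F ->
  prime_chain d.+1 (chain_cons P F).
Proof.
by move=> pP PF [pF ltF]; split=> -[|i] // id; [apply: pF|apply: ltF].
Qed.

Lemma prime_chain_behead d F : prime_chain d.+1 F -> prime_chain d (F \o succn).
Proof. by case=> pF ltF; split=> i id; [exact: pF i.+1 id|exact: ltF i.+1 id]. Qed.

Lemma prime_chain_sub d F i : prime_chain d F -> (i <= d)%N -> F i `<=` F d.
Proof.
case=> _ ltF id; rewrite -(subnKC id).
have : (i + (d - i) <= d)%N by rewrite subnKC.
elim: (d - i)%N => [|k IHk]; first by rewrite addn0 => _ x.
rewrite addnS => ikd; apply: subset_trans (IHk (ltnW ikd)) _.
by have [] := ltF _ ikd.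
Qed.

(** The element [x] descends one step at a time: induction brings it into the second prime of the
    tail, then the principal ideal theorem replaces the first prime of the tail by one containing
    [x]. *)
Lemma prime_chain_through d F x :
    all_fin_gen R -> prime_chain d.+2 F -> F d.+2 x ->
  exists G, [/\ prime_chain d.+2 G, G 0%N = F 0%N & G 1%N x].
Proof.
move=> noeR; elim: d F => [|d IHd] F cF Fx.
  have [pF ltF] := cF.
  have [//|//|//|//|//|//|//|Q [pQ F0Q QF2 Qx]] := @principal_ideal_theorem R
    (F 0%N) (F 1%N) (F 2%N) x; try by [apply: pF|apply: ltF].
  exists (chain_cons (F 0%N) (chain_cons Q (fun=> F 2%N))); split=> //.
  apply: prime_chain_cons => //; first exact: pF.
  by apply: prime_chain_cons => //; apply: prime_chain0; apply: pF.
have [G [cG G0 G1x]] := IHd _ (prime_chain_behead cF) Fx.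
have [[pF ltF] [pG ltG]] := (cF, cG).
have [||||||Q [pQ F0Q QF2 Qx]] := @principal_ideal_theorem R
    (F 0%N) (G 0%N) (G 1%N) x noeR.
- exact: pF.
- exact: pG.
- exact: pG.
- by rewrite G0; apply: ltF.
- exact: ltG.
- exact: G1x.
exists (chain_cons (F 0%N) (chain_cons Q (G \o succn))); split=> //.
apply: prime_chain_cons => //; first exact: pF.
by apply: prime_chain_cons => //; apply: prime_chain_behead.
Qed.

End Chains.

Section HilbertBasis.
Variable R : comNzRingType.
Implicit Types (I J : set {poly R}) (f g h : {poly R}).

(** Leading coefficients in degree [d]; bounding the size instead of fixing it admits 0 and sums
    whose leading terms cancel. *)
Definition coef_ideal I d : set R :=
  [set a | exists f, [/\ I f, (size f <= d.+1)%N & f`_d = a]].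

Lemma coef_idealP I d : ideal I -> ideal (coef_ideal I d).
Proof.
move=> idI; split.
- by exists 0; rewrite size_poly0 coef0; split=> //; apply: ideal0.
- move=> _ _ [f [If sf <-]] [g [Ig sg <-]]; exists (f + g).
  split; [exact: idealD| |by rewrite coefD].
  by rewrite (leq_trans (size_polyD _ _)) // geq_max sf.
- move=> a _ [f [If sf <-]]; exists (a *: f).
  split; [by rewrite -mul_polyC; apply: idealM| |by rewrite coefZ].
  exact: leq_trans (size_scale_leq _ _) sf.
Qed.

Lemma coef_ideal_mono I d e : ideal I -> (d <= e)%N ->
  coef_ideal I d `<=` coef_ideal I e.
Proof.
move=> idI de _ [f [If sf <-]]; exists ('X^(e - d) * f); split.
- exact: idealM.
- have [->|f0] := eqVneq f 0; first by rewrite mulr0 size_poly0.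
  by rewrite mulrC size_mulXn // -(leq_add2l (e - d)) in sf *; rewrite addnS subnK in sf.
- by rewrite coefXnM ltnNge leq_subr /= subKn.
Qed.

Lemma size_sub_lead f h d : (size f <= d.+1)%N -> (size h <= d.+1)%N ->
  h`_d = f`_d -> (size (f - h)%R <= d)%N.
Proof.
move=> sf sh hf; apply/leq_sizeP => j; rewrite leq_eqVlt coefB => /predU1P[<-|dj].
  by rewrite hf subrr.
by rewrite !nth_default ?subrr // (leq_trans _ dj).
Qed.

(** Induction on [d]: lifts of generators of the coefficient ideal cancel the top coefficient and so
    reduce the size. *)
Lemma fin_gen_bounded_size I d : all_fin_gen R -> ideal I ->
  exists s : seq {poly R}, (forall f, f \in s -> I f) /\
    forall J, ideal J -> (forall f, f \in s -> J f) ->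
      forall f, I f -> (size f <= d)%N -> J f.
Proof.
move=> noeR idI; elim: d => [|d [s [sI gens]]].
  exists [::]; split=> // J idJ _ f _.
  by rewrite leqn0 size_poly_eq0 => /eqP ->; apply: ideal0.
have [t [tL gent]] := noeR _ (coef_idealP d idI).
have [u [uI ut]] : exists u : seq {poly R}, (forall f, f \in u -> I f) /\
    forall a, a \in t -> exists f, [/\ f \in u, (size f <= d.+1)%N & f`_d = a].
  elim: t tL {gent} => [|a t IHt] tL; first by exists [::].
  have [b bt|u [uI ut]] := IHt; first by apply: tL; rewrite inE bt orbT.
  have [|f [If sf fa]] := tL a; first by rewrite inE eqxx.
  exists (f :: u); split=> [g|b]; first by rewrite inE => /predU1P[->|/uI].
  rewrite inE => /predU1P[->|/ut[g [gu sg gb]]].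
    by exists f; rewrite inE eqxx.
  by exists g; rewrite inE gu orbT.
exists (s ++ u); split=> [f|J idJ suJ f If sf].
  by rewrite mem_cat => /orP[/sI|/uI].
(* Testing [t] against the coefficient ideal of the intersection yields [h] in [I] as well as in
   [J], so that [f - h] stays in [I]. *)
have idIJ : ideal (I `&` J).
  split; first by split; apply: ideal0.
    by move=> x y [Ix Jx] [Iy Jy]; split; apply: idealD.
  by move=> a x [Ix Jx]; split; apply: idealM.
have [|||h [[Ih Jh] sh hf]] := gent (coef_ideal (I `&` J) d) _ _ f`_d.
- exact: coef_idealP.
- move=> a /ut[g [gu sg ga]]; exists g; split=> //; split; first exact: uI.
  by apply: suJ; rewrite mem_cat gu orbT.
- by exists f.
rewrite -(subrK h f); apply: idealD => //; apply: (gens J idJ) => //.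
- by move=> g gs; apply: suJ; rewrite mem_cat gs.
- exact: idealB.
- by apply: size_sub_lead.
Qed.

(** The coefficient ideals increase with the degree, so one of them, of index [D], is the largest.
    The elements of size at most [D.+1] then generate [I]: in a higher degree [d], the top
    coefficient is cancelled by ['X^(d - D) * h] with [h] among them. *)
Theorem hilbert_basis : all_fin_gen R -> all_fin_gen {poly R}.
Proof.
move=> noeR I idI.
have [|||_ [[D ->] maxD]] := @noetherian_maximal R
  [set L | exists d, L = coef_ideal I d] (coef_ideal I 0).
- exact: noeR.
- by move=> _ [d ->]; apply: coef_idealP.
- by exists 0%N.
have [s [sI gens]] := fin_gen_bounded_size D.+1 noeR idI.
exists s; split=> // J idJ sJ f.
have [k] := ubnP (size f); elim: k f => // k IHk f; rewrite ltnS => fk If.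
have [sf|] := leqP (size f) D.+1; first exact: (gens J).
case sz: (size f) => [//|d]; rewrite ltnS => Dd.
have : coef_ideal I d f`_d by exists f; rewrite sz.
move/(maxD _ (ex_intro _ d erefl) (coef_ideal_mono idI (ltnW Dd))).
move=> [h [Ih sh hf]].
rewrite -(subrK ('X^(d - D) * h) f); apply: idealD => //; last first.
  by apply: idealM => //; apply: (gens J).
apply: IHk; last by apply: idealB => //; apply: idealM.
apply: leq_trans fk; rewrite sz ltnS; apply: size_sub_lead.
- by rewrite sz.
- apply: leq_trans (size_polyMleq _ _) _; rewrite size_polyXn addSn /=.
  by rewrite -(subnK (ltnW Dd)) addnK -addnS leq_add2l.
- by rewrite coefXnM ltnNge leq_subr /= subKn // ltnW.
Qed.

End HilbertBasis.

Section PolynomialFibres.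
Variable R : comNzRingType.
Implicit Types (P Q : set {poly R}) (f g q r : {poly R}).

(** The leading coefficient of [f] may be a zero divisor, so [g] is scaled by a power of it.
    Truncated subtraction in the bound on [q] forces [q = 0] when [g] is shorter than [f]. *)
Lemma pseudo_division f g : f != 0 -> exists k q r,
  [/\ lead_coef f ^+ k *: g = q * f + r, (size r < size f)%N
    & (size q <= (size g).+1 - size f)%N].
Proof.
move=> f0; have [n] := ubnP (size g); elim: n g => // n IHn g; rewrite ltnS => gn.
have [gf|fg] := ltnP (size g) (size f).
  by exists 0%N, 0, g; rewrite scale1r mul0r add0r size_poly0.
pose m := (size g - size f)%N.
pose g' := lead_coef f *: g - lead_coef g *: 'X^m * f.
have g0 : (0 < size g)%N by apply: leq_trans fg; rewrite size_poly_gt0.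
have sf : (size f).-1.+1 = size f by rewrite prednK // size_poly_gt0.
have sg' : (size g' < size g)%N.
  rewrite -(prednK g0) ltnS; apply: size_sub_lead; rewrite ?prednK //.
  - exact: size_scale_leq.
  - rewrite -scalerAl (leq_trans (size_scale_leq _ _)) //.
    by rewrite mulrC size_mulXn // addnC subnKC.
  - rewrite -scalerAl !coefZ coefXnM ltnNge.
    have mg : (m <= (size g).-1)%N
      by rewrite -ltnS prednK // ltn_subrL size_poly_gt0 f0.
    rewrite mg /= mulrC; congr (_ * _); rewrite /lead_coef; congr (_`_ _).
    by rewrite -!subn1 subnAC subKn.
have [k [q [r [e sr sq]]]] := IHn g' (leq_trans sg' gn).
exists k.+1, (q + (lead_coef f ^+ k * lead_coef g) *: 'X^m), r; split=> //.
  rewrite mulrDl addrAC -e /g' scalerBr scalerA -exprSr -!scalerAl scalerA.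
  by rewrite subrK.
rewrite (leq_trans (size_polyD _ _)) // geq_max (leq_trans sq) /=.
  by rewrite (leq_trans (size_scale_leq _ _)) // size_polyXn subSn.
by rewrite leq_sub2r // ltnS ltnW.
Qed.

(** For an ideal P, this is the extension to R[X] of the contraction of P to R. *)
Definition coefs_in P f := forall i, P (f`_i)%:P.

Lemma coefs_inP P f : ideal P -> coefs_in P f -> P f.
Proof.
move=> idP Pf; rewrite -[f]coefK poly_def.
elim/big_ind: _ => [|x y|i _]; first exact: ideal0; first exact: idealD.
by rewrite -mul_polyC mulrC; apply: idealM.
Qed.

Lemma coefs_in_ideal P : ideal P -> ideal (coefs_in P).
Proof.
move=> idP; split.
- by move=> i; rewrite coef0 rmorph0; apply: ideal0.
- by move=> f g Pf Pg i; rewrite coefD rmorphD; apply: idealD; [|apply: Pf|apply: Pg].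
- move=> a f Pf i; rewrite coefM rmorph_sum.
  elim/big_ind: _ => [|x y|j _]; first exact: ideal0; first exact: idealD.
  by rewrite rmorphM; apply: idealM => //; apply: Pf.
Qed.

(* Choose f of least degree among the elements of Q having a coefficient outside
   P; then f is not in P, for otherwise Q would equal P. Up to a scalar and
   modulo coefficients in P, every g in P is a multiple q f with q in P of smaller
   degree than g, so descent on the degree applies. *)
Lemma coefs_in_prime P Q : prime_ideal P -> prime_ideal Q -> P `<` Q ->
    (forall a, Q a%:P -> P a%:P) ->
  P `<=` coefs_in P.
Proof.
move=> pP pQ [PQ nQP] QP.
have [idP idQ] := (prime_idealP pP, prime_idealP pQ).
have idC := coefs_in_ideal idP.
have [f [Qf nCf minf]] : exists f, [/\ Q f, ~ coefs_in P f &
    forall g, Q g -> (size g < size f)%N -> coefs_in P g].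
  have [f Qf nPf] : exists2 f, Q f & ~ coefs_in P f.
    by move/existsNP: nQP => [f /not_implyP[Qf nPf]]; exists f => // /(coefs_inP idP).
  have ex : exists n, `[< exists f, [/\ Q f, ~ coefs_in P f & size f = n] >].
    by exists (size f); apply/asboolP; exists f.
  case: (ex_minnP ex) => _ /asboolP[h [Qh nCh <-]] minh.
  exists h; split=> // g Qg gh; apply: contrapT => nCg.
  by move: gh; rewrite ltnNge minh //; apply/asboolP; exists g.
have f0 : f != 0 by apply: contra_notN nCf => /eqP ->; apply: (ideal0 idC).
(* Otherwise dropping the leading term gives a shorter element of [Q]; by minimality its
   coefficients lie in [P], and then so do those of [f]. *)
have nPc : ~ P (lead_coef f)%:P.
  move=> Pc; have Pm : coefs_in P ((lead_coef f)%:P * 'X^((size f).-1)).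
    move=> i; rewrite coefCM rmorphM mulrC; exact: idealM.
  apply: nCf; rewrite -(subrK ((lead_coef f)%:P * 'X^((size f).-1)) f).
  apply: (idealD idC) => //; apply: minf.
    by apply: idealB => //; apply: PQ (coefs_inP idP Pm).
  rewrite -[ltnRHS]prednK ?size_poly_gt0 // ltnS; apply: size_sub_lead.
  - by rewrite prednK ?size_poly_gt0.
  - by rewrite mul_polyC (leq_trans (size_scale_leq _ _)) // size_polyXn.
  - by rewrite coefCM coefXn eqxx mulr1.
have nPck k : ~ P (lead_coef f ^+ k)%:P.
  by rewrite rmorphXn; apply: prime_notX.
have nPf : ~ P f.
  move=> Pf; apply: nQP => g Qg; have [k [q [r [e sr _]]]] := pseudo_division g f0.
  have Qr : Q r.
    have -> : r = (lead_coef f ^+ k)%:P * g - q * f by rewrite mul_polyC e addrC addKr.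
    by apply: idealB => //; apply: idealM.
  apply: (prime_mem pP _ (nPck k)); rewrite mul_polyC e.
  by apply: idealD => //; [apply: idealM|apply: coefs_inP (minf _ Qr sr)].
(* A constant [f] would lie in [P] by hypothesis. Size at least 2 makes the quotient [q] shorter
   than [g]. *)
have sf : (1 < size f)%N.
  rewrite ltnNge; apply/negP => sf; apply: nPc; apply: QP.
  have s0 : (size f).-1 = 0%N by case: (size f) sf => [|[]].
  by rewrite /lead_coef s0 -size1_polyC.
move=> g; have [n] := ubnP (size g); elim: n g => // n IHn g; rewrite ltnS => gn Pg.
have [g0|g0] := eqVneq g 0; first by rewrite g0; apply: (ideal0 idC).
have [k [q [r [e sr sq]]]] := pseudo_division g f0.
have Qr : Q r.
  have -> : r = (lead_coef f ^+ k)%:P * g - q * f by rewrite mul_polyC e addrC addKr.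
  by apply: idealB => //; apply: idealM => //; apply: PQ.
have Cr := minf _ Qr sr.
have Cq : coefs_in P q.
  apply: IHn.
    apply: leq_ltn_trans sq _; apply: leq_trans gn.
    by rewrite ltn_psubLR ?size_poly_gt0 // -[(size g).+1]add1n ltn_add2r.
  apply: (prime_mem pP (x := f)) => //.
  have -> : f * q = (lead_coef f ^+ k)%:P * g - r by rewrite mul_polyC e addrK mulrC.
  by apply: idealB => //; [apply: idealM|apply: coefs_inP].
have : coefs_in P (lead_coef f ^+ k *: g).
  by rewrite e; apply: (idealD idC) => //; rewrite mulrC; apply: (idealM _ idC).
move=> Ckg i; apply: (prime_mem pP _ (nPck k)).
by rewrite -rmorphM -coefZ; apply: Ckg.
Qed.

(** Prescribing the first prime of [G] lets the induction put a further contraction in front of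
    it. *)
Theorem prime_chain_poly d (F : nat -> set {poly R}) :
    all_fin_gen {poly R} -> prime_chain d F ->
  exists G, prime_chain d.-1 G /\ G 0%N = polyC @^-1` F 0%N.
Proof.
move=> noeR; elim: d F => [|[|d] IHd] F cF.
- by exists (fun=> polyC @^-1` F 0%N); split=> //; apply/prime_chain0/prime_preimage/cF.1.
- by exists (fun=> polyC @^-1` F 0%N); split=> //; apply/prime_chain0/prime_preimage/cF.1.
have [pF ltF] := cF.
(* Otherwise the first three primes have the same contraction to R; [coefs_in_prime] then puts the
   coefficients of every element of [F 1] into [F 0], whence [F 1] is inside [F 0]. *)
have [a Fda nF0a] : exists2 a, F d.+2 a%:P & ~ F 0%N a%:P.
  apply: contrapT => nex.
  have FF0 a i : (i <= d.+2)%N -> F i a%:P -> F 0%N a%:P.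
    move=> id Fa; apply: contrapT => nF0; apply: nex; exists a => //.
    exact: (prime_chain_sub cF id).
  have [F01 nF10] : F 0%N `<` F 1%N by apply: ltF.
  have [F12 nF21] : F 1%N `<` F 2%N by apply: ltF.
  apply: nF10 => f /(@coefs_in_prime (F 1%N) (F 2%N)) Cf.
  apply: coefs_inP; first by have [] := pF 0%N.
  move=> i; apply: (FF0 _ 1%N) => //; apply: Cf; [exact: pF|exact: pF|by []|].
  by move=> b /(FF0 _ 2%N isT) /F01.
have [G [cG G0 G1a]] := prime_chain_through noeR cF Fda.
have [H [cH H0]] := IHd _ (prime_chain_behead cG).
exists (chain_cons (polyC @^-1` F 0%N) H); split=> //.
apply: prime_chain_cons => //; first exact/prime_preimage/pF.
rewrite H0 -G0; split=> [b /=|/(_ a G1a)]; last by rewrite /= G0.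
by have [G01 _] : G 0%N `<` G 1%N; [apply: cG.2|apply: G01].
Qed.

End PolynomialFibres.

(** * Residue fields, polynomial morphisms and fractions *)

Lemma prime_kernel (R : comPzRingType) (S : idomainType) (h : {rmorphism R -> S}) :
  prime_ideal [set x | h x = 0].
Proof.
split=> [|/=|x y /= /eqP].
- split=> /= [|x y hx hy|a x hx]; first exact: rmorph0.
    by rewrite rmorphD hx hy addr0.
  by rewrite rmorphM hx mulr0.
- by rewrite rmorph1 => /eqP; rewrite oner_eq0.
- by rewrite rmorphM mulf_eq0 => /orP[]/eqP; [left|right].
Qed.

Section ResidueField.
Variables (R : comNzRingType) (P : set R) (pP : prime_ideal P).

(** The proof of primality is an argument so that the ideal structures below can be attached to the
    predicate. *)
Definition ideal_pred of prime_ideal P : {pred R} := fun x => `[< P x >].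

Local Notation I := (ideal_pred pP).

Fact ideal_pred_closed : idealr_closed I.
Proof.
have [idP P1 _] := pP; split.
- by apply/asboolP; apply: ideal0.
- by apply/negP => /asboolP.
- move=> a x y /asboolP Px /asboolP Py; apply/asboolP.
  by apply: idealD => //; apply: idealM.
Qed.

Fact ideal_pred_prime : prime_idealr_closed I.
Proof.
have [_ _ PM] := pP; move=> x y /asboolP/PM[] Pz; apply/orP; [left|right];
exact/asboolP.
Qed.

HB.instance Definition _ := isIdealr.Build R I ideal_pred_closed.
HB.instance Definition _ := isPrimeIdealrClosed.Build R I ideal_pred_prime.

Definition prime_quotient : Type := {ideal_quot I}.
HB.instance Definition _ := GRing.ComNzRing.on prime_quotient.

Let is_unit (x : prime_quotient) : bool := `[< exists y, y * x = 1 >].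
Let inverse (x : prime_quotient) : prime_quotient :=
  if pselect (exists y, y * x = 1) is left ex then projT1 (cid ex) else x.

Fact prime_quotient_mulV : {in is_unit, left_inverse 1 inverse *%R}.
Proof.
move=> x /asboolP ex; rewrite /inverse; case: pselect => // ex'.
exact: projT2 (cid ex').
Qed.

Fact prime_quotient_unit x y : y * x = 1 -> is_unit x.
Proof. by move=> yx; apply/asboolP; exists y. Qed.

Fact prime_quotient_inv_out : {in [predC is_unit], inverse =1 id}.
Proof.
move=> x nx; rewrite /inverse; case: pselect => // ex.
by case/asboolP: nx.
Qed.

HB.instance Definition _ := GRing.ComNzRing_hasMulInverse.Build prime_quotient
  prime_quotient_mulV prime_quotient_unit prime_quotient_inv_out.

Fact prime_quotient_integral : GRing.integral_domain_axiom prime_quotient.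
Proof. exact: Quotient.rquot_IdomainAxiom. Qed.

HB.instance Definition _ :=
  GRing.ComUnitRing_isIntegral.Build prime_quotient prime_quotient_integral.

(** The field is the fraction field of R / P. Presenting primes as kernels lets primality of their
    extensions be proved by extending the map. *)
Lemma residue_field : exists (L : fieldType) (h : {rmorphism R -> L}),
  P = [set x | h x = 0].
Proof.
pose h : {rmorphism R -> prime_quotient} := \pi_({ideal_quot I})%qT.
exists {fraction prime_quotient}, (@FracField.tofrac prime_quotient \o h).
have hE x : (h x == 0) = (x \in I).
  by rewrite -(rmorph0 h) /h /= -Quotient.idealrBE subr0.
apply/funext => x; apply/propext; split=> /= [Px|/eqP].
  by apply/eqP; rewrite tofrac_eq0 hE; apply/asboolP.
by rewrite tofrac_eq0 hE => /asboolP.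
Qed.

End ResidueField.

Section PolynomialMorphisms.
Variables (R : comNzRingType) (n : nat).

Lemma mpoly_rmorph_eq (S : comPzRingType) (f g : {rmorphism {mpoly R[n]} -> S}) :
    (forall a, f (mpolyC n a) = g (mpolyC n a)) ->
    (forall i, f (polyvar R i) = g (polyvar R i)) ->
  f =1 g.
Proof.
move=> fgC fgX p; rewrite (mpolyE p) !rmorph_sum; apply: eq_bigr => m _.
rewrite -mul_mpolyC !rmorphM fgC mpolyXE_id !rmorph_prod; congr (_ * _).
by apply: eq_bigr => i _; rewrite !rmorphXn fgX.
Qed.

(* [mmap] is only available for nonzero target rings. *)
Lemma mpoly_rmorph_exists (S : comPzRingType) (f : {rmorphism R -> S}) (v : 'I_n -> S) :
  exists g : {rmorphism {mpoly R[n]} -> S},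
    (forall a, g (mpolyC n a) = f a) /\ (forall i, g (polyvar R i) = v i).
Proof.
have [S0|S1] := eqVneq (1 : S) 0.
  have all_eq (x y : S) : x = y by rewrite -[x]mul1r -[y]mul1r S0 !mul0r.
  pose g (p : {mpoly R[n]}) : S := 0.
  have gD : nmod_morphism g by split=> // p q; apply: all_eq.
  have gM : monoid_morphism g by split=> // p q; apply: all_eq.
  pose gA := GRing.isNmodMorphism.Build _ _ g gD.
  pose gR := GRing.isMonoidMorphism.Build _ _ g gM.
  pose g' : {rmorphism {mpoly R[n]} -> S} := HB.pack g gA gR.
  by exists g'; split=> *; apply: all_eq.
pose S' : comNzRingType := HB.pack (GRing.ComPzRing.sort S)
  (GRing.PzSemiRing_isNonZero.Build S S1).
pose f' : {rmorphism R -> S'} := f.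
pose g : {rmorphism {mpoly R[n]} -> S'} := mmap f' (v : 'I_n -> S').
exists g; split=> [a|i]; first exact: (@mmapC n R S' v f' a).
exact: etrans (@mmapX n R S' v f' (mnm1 i)) (@mmap1U n S' v i).
Qed.

Lemma mpoly_surj (S : comPzRingType) (f : {rmorphism S -> {mpoly R[n]}}) :
    (forall a, exists x, f x = mpolyC n a) ->
    (forall i, exists x, f x = polyvar R i) ->
  forall p, exists x, f x = p.
Proof.
move=> fC fX p; rewrite (mpolyE p).
elim/big_ind: _ => [|_ _ [x <-] [y <-]|m _]; first by exists 0; rewrite rmorph0.
  by exists (x + y); rewrite rmorphD.
have [x fx] := fC (mcoeff m p); rewrite -mul_mpolyC -fx mpolyXE_id.
have [y <-] : exists y, f y = \prod_(i < n) polyvar R i ^+ m i.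
  elim/big_ind: _ => [|_ _ [y <-] [z <-]|i _]; first by exists 1; rewrite rmorph1.
    by exists (y * z); rewrite rmorphM.
  by have [y <-] := fX i; exists (y ^+ m i); rewrite rmorphXn.
by exists (x * y); rewrite rmorphM.
Qed.

End PolynomialMorphisms.

Section Fractions.
Variable R : idomainType.
Local Notation tofrac := (@FracField.tofrac R).

Lemma fractionE (x : {fraction R}) :
  exists p q, q != 0 /\ x * tofrac q = tofrac p.
Proof.
elim/quotW: x => r; exists (frac r).1, (frac r).2.
have d0 := denom_ratioP r; split=> //.
unlock FracField.tofrac; rewrite -[LHS]FracField.pi_mul; apply/eqmodP.
rewrite /= FracField.equivfE /FracField.mulf /= !numden_Ratio ?mulr1 ?oner_eq0 //.
by rewrite mulrC.
Qed.

Lemma fraction_lift (L : fieldType) (g : {rmorphism R -> L}) :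
    (forall p, g p = 0 -> p = 0) ->
  exists h : {rmorphism {fraction R} -> L}, forall p, h (tofrac p) = g p.
Proof.
move=> g_inj.
have g0 q : q != 0 -> g q != 0 by apply: contra_neq => /g_inj.
(* The value [y] fits all presentations of [x] as a fraction at once, so the morphism laws may be
   checked on convenient ones. *)
have cross x : exists y, forall p q, q != 0 -> x * tofrac q = tofrac p ->
    y * g q = g p.
  have [p [q [q0 xq]]] := fractionE x; exists (g p / g q) => p' q' q'0 xq'.
  apply: (mulIf (g0 q q0)); rewrite mulrAC divfK ?g0 // -!rmorphM; congr (g _).
  by apply/eqP; rewrite -tofrac_eq !tofracM -xq -xq' mulrAC.
pose h x := projT1 (cid (cross x)).
have hE x p q : q != 0 -> x * tofrac q = tofrac p -> h x * g q = g p.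
  exact: projT2 (cid (cross x)) p q.
have hD : nmod_morphism h.
  split.
    have := @hE 0 0 1 (oner_neq0 _).
    by rewrite tofrac1 tofrac0 rmorph0 rmorph1 !mulr1; apply.
  move=> x y; have [p [q [q0 xq]]] := fractionE x.
  have [p' [q' [q'0 yq]]] := fractionE y.
  apply: (mulIf (g0 _ (mulf_neq0 q0 q'0))).
  rewrite (hE _ (p * q' + p' * q)) ?mulf_neq0 //.
    rewrite rmorphD !rmorphM -(hE x p q) // -(hE y p' q') //; ring.
  by rewrite tofracD !tofracM -xq -yq; ring.
have hM : monoid_morphism h.
  split.
    by have := @hE 1 1 1 (oner_neq0 _); rewrite rmorph1 tofrac1 !mulr1; apply.
  move=> x y; have [p [q [q0 xq]]] := fractionE x.
  have [p' [q' [q'0 yq]]] := fractionE y.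
  apply: (mulIf (g0 _ (mulf_neq0 q0 q'0))).
  rewrite (hE _ (p * p')) ?mulf_neq0 //.
    by rewrite !rmorphM -(hE x p q) // -(hE y p' q') //; ring.
  by rewrite !tofracM -xq -yq; ring.
pose hA := GRing.isNmodMorphism.Build _ _ h hD.
pose hR := GRing.isMonoidMorphism.Build _ _ h hM.
pose h' : {rmorphism {fraction R} -> L} := HB.pack h hA hR.
exists h' => p; have := @hE (tofrac p) p 1 (oner_neq0 _).
by rewrite rmorph1 tofrac1 !mulr1; apply.
Qed.

End Fractions.

(** * The tensor product as a localization of a polynomial ring *)

Section TensorTheory.
Variables (K : comNzRingType) (B A : comAlgType K).
Local Notation T := (tensor K B A).

Lemma pure_tensorDl b b' a :
  pure_tensor (b + b') a = pure_tensor b a + pure_tensor b' a :> T.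
Proof.
by rewrite [LHS](tensor_eq (teq_Dl _ _ _)) -(pi_tensor_add [:: _] [:: _]). Qed.

Lemma pure_tensorDr b a a' :
  pure_tensor b (a + a') = pure_tensor b a + pure_tensor b a' :> T.
Proof.
by rewrite [LHS](tensor_eq (teq_Dr _ _ _)) -(pi_tensor_add [:: _] [:: _]). Qed.

Lemma pure_tensor0l a : pure_tensor 0 a = 0 :> T.
Proof. exact: tensor_eq (teq_0l _ _). Qed.

Lemma pure_tensor0r b : pure_tensor b 0 = 0 :> T.
Proof. exact: tensor_eq (teq_0r _ _). Qed.

Lemma pure_tensorM b a b' a' :
  pure_tensor (b * b') (a * a') = pure_tensor b a * pure_tensor b' a' :> T.
Proof. by rewrite [RHS](pi_tensor_mul [:: _] [:: _]). Qed.

Lemma pure_tensorZ k b a : pure_tensor (k *: b) a = pure_tensor b (k *: a) :> T.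
Proof. exact: tensor_eq (teq_Z _ _ _). Qed.

Lemma tensor_sum (s : seq (B * A)) :
  (\pi_T s)%qT = \sum_(p <- s) pure_tensor p.1 p.2 :> T.
Proof.
elim: s => [|[b a] s IHs]; first by rewrite big_nil.
by rewrite big_cons -IHs; apply: esym (pi_tensor_add [:: (b, a)] s).
Qed.

Definition tensor_inl (b : B) : T := pure_tensor b 1.
Definition tensor_inr (a : A) : T := pure_tensor 1 a.

Fact tensor_inl_nmod_morphism : nmod_morphism tensor_inl.
Proof. by split=> [|b b']; [apply: pure_tensor0l|apply: pure_tensorDl]. Qed.

Fact tensor_inl_monoid_morphism : monoid_morphism tensor_inl.
Proof. by split=> // b b'; rewrite /tensor_inl -pure_tensorM mulr1. Qed.

Fact tensor_inr_nmod_morphism : nmod_morphism tensor_inr.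
Proof. by split=> [|a a']; [apply: pure_tensor0r|apply: pure_tensorDr]. Qed.

Fact tensor_inr_monoid_morphism : monoid_morphism tensor_inr.
Proof. by split=> // a a'; rewrite /tensor_inr -pure_tensorM mulr1. Qed.

HB.instance Definition _ :=
  GRing.isNmodMorphism.Build B T tensor_inl tensor_inl_nmod_morphism.
HB.instance Definition _ :=
  GRing.isMonoidMorphism.Build B T tensor_inl tensor_inl_monoid_morphism.
HB.instance Definition _ :=
  GRing.isNmodMorphism.Build A T tensor_inr tensor_inr_nmod_morphism.
HB.instance Definition _ :=
  GRing.isMonoidMorphism.Build A T tensor_inr tensor_inr_monoid_morphism.

Lemma pure_tensorE b a : pure_tensor b a = tensor_inl b * tensor_inr a.
Proof. by rewrite -pure_tensorM mulr1 mul1r. Qed.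

Lemma tensor_inlA k : tensor_inl k%:A = tensor_inr k%:A.
Proof. exact: pure_tensorZ. Qed.

(** Universal property: evaluation of formal sums respects every relation generating [teq], the
    relation [teq_Z] because [f] and [g] agree on scalars. *)
Lemma tensor_lift (S : comPzRingType) (f : {rmorphism B -> S})
    (g : {rmorphism A -> S}) :
    (forall k, f k%:A = g k%:A) ->
  exists h : {rmorphism T -> S},
    (forall b, h (tensor_inl b) = f b) /\ (forall a, h (tensor_inr a) = g a).
Proof.
move=> fg; pose ev (s : seq (B * A)) := \sum_(p <- s) f p.1 * g p.2.
have ev_teq s t : teq s t -> ev s = ev t.
  rewrite /ev; elim=> {s t} //=.
  - by move=> s t u _ -> _ ->.
  - by move=> s s' t t' _ ss' _ tt'; rewrite !big_cat ss' tt'.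
  - by move=> s t; rewrite !big_cat /= addrC.
  - by move=> a; rewrite big_seq1 big_nil rmorph0 mul0r.
  - by move=> b; rewrite big_seq1 big_nil rmorph0 mulr0.
  - by move=> b b' a; rewrite !big_cons !big_nil !addr0 /= rmorphD mulrDl.
  - by move=> b a a'; rewrite !big_cons !big_nil !addr0 /= rmorphD mulrDr.
  - move=> k b a; rewrite !big_seq1 /= -[k *: b]mulr_algl -[k *: a]mulr_algl.
    by rewrite !rmorphM fg mulrA [g _ * f b]mulrC.
pose h (t : T) := ev (repr t).
have hpi s : h (\pi_T s)%qT = ev s by apply/ev_teq/teq_repr.
have hD : nmod_morphism h.
  split; first by rewrite [LHS]hpi /ev big_nil.
  elim/quotW=> s; elim/quotW=> t; rewrite [_ + _]pi_tensor_add !hpi.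
  by rewrite /ev big_cat.
have hM : monoid_morphism h.
  split; first by rewrite [LHS]hpi /ev big_seq1 !rmorph1 mulr1.
  elim/quotW=> s; elim/quotW=> t; rewrite [_ * _]pi_tensor_mul !hpi.
  rewrite /ev big_allpairs_dep big_distrl /=; apply: eq_bigr => p _.
  rewrite big_distrr; apply: eq_bigr => q _ /=.
  by rewrite !rmorphM mulrACA.
pose hA := GRing.isNmodMorphism.Build _ _ h hD.
pose hR := GRing.isMonoidMorphism.Build _ _ h hM.
pose h' : {rmorphism T -> S} := HB.pack h hA hR.
by exists h'; split=> [b|a]; rewrite [LHS]hpi /ev big_seq1 rmorph1 (mulr1, mul1r).
Qed.

End TensorTheory.

Section RationalTensor.
Variables (K : fieldType) (A : comAlgType K) (n : nat).
Local Notation T := (tensor K (ratfun K n) A).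
Local Notation tofrac := (@FracField.tofrac {mpoly K[n]}).

Lemma ratfun_scalar (k : K) : k%:A = tofrac (mpolyC n k) :> ratfun K n.
Proof. exact: mulr1. Qed.

Lemma mpoly_scalars : exists f : {rmorphism {mpoly K[n]} -> {mpoly A[n]}},
  (forall k, f (mpolyC n k) = mpolyC n k%:A) /\
  (forall i, f (polyvar K i) = polyvar A i).
Proof.
pose c : {rmorphism K -> {mpoly A[n]}} := @mpolyC n A \o in_alg A.
exact: (mpoly_rmorph_exists c (fun i => polyvar A i)).
Qed.

Definition scalars : {rmorphism {mpoly K[n]} -> {mpoly A[n]}} :=
  projT1 (cid mpoly_scalars).

Lemma scalarsC k : scalars (mpolyC n k) = mpolyC n k%:A.
Proof. exact: (projT2 (cid mpoly_scalars)).1. Qed.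

Lemma scalarsX i : scalars (polyvar K i) = polyvar A i.
Proof. exact: (projT2 (cid mpoly_scalars)).2. Qed.

Lemma mpoly_to_tensor_exists : exists f : {rmorphism {mpoly A[n]} -> T},
  (forall a, f (mpolyC n a) = tensor_inr _ a) /\
  (forall i, f (polyvar A i) = tensor_inl _ (tofrac (polyvar K i) : ratfun K n)).
Proof. exact: mpoly_rmorph_exists. Qed.

Definition mpoly_to_tensor : {rmorphism {mpoly A[n]} -> T} :=
  projT1 (cid mpoly_to_tensor_exists).

Local Notation inl q := (tensor_inl A (tofrac q : ratfun K n)).

Lemma mpoly_to_tensorC a : mpoly_to_tensor (mpolyC n a) = tensor_inr _ a.
Proof. exact: (projT2 (cid mpoly_to_tensor_exists)).1. Qed.

Lemma mpoly_to_tensorX i : mpoly_to_tensor (polyvar A i) = inl (polyvar K i).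
Proof. exact: (projT2 (cid mpoly_to_tensor_exists)).2. Qed.

Lemma mpoly_to_tensor_scalars p : mpoly_to_tensor (scalars p) = inl p.
Proof.
pose f : {rmorphism {mpoly K[n]} -> T} := mpoly_to_tensor \o scalars.
pose c : {rmorphism {mpoly K[n]} -> ratfun K n} := tofrac.
pose g : {rmorphism {mpoly K[n]} -> T} := tensor_inl A \o c.
apply: (@mpoly_rmorph_eq _ _ _ f g) => [k|i] /=.
  by rewrite scalarsC mpoly_to_tensorC -tensor_inlA ratfun_scalar.
by rewrite scalarsX mpoly_to_tensorX.
Qed.

Lemma tensor_denominator t : exists q f,
  q != 0 /\ inl q * t = mpoly_to_tensor f.
Proof.
elim/quotW: t => s; rewrite tensor_sum.
elim: s => [|[b a] s [q [f [q0 e]]]].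
  by exists 1, 0; rewrite big_nil mulr0 rmorph0 oner_eq0.
have [p [q' [q'0 bq]]] := fractionE b.
exists (q' * q), (scalars q * scalars p * mpolyC n a + scalars q' * f).
rewrite mulf_neq0 // big_cons mulrDr; split=> //.
rewrite rmorphD !rmorphM !mpoly_to_tensor_scalars mpoly_to_tensorC -e.
have -> : inl p = tensor_inl A b * inl q' by rewrite -bq; apply: rmorphM.
by rewrite pure_tensorE /=; ring.
Qed.

Lemma inl_unit q : q != 0 -> exists u, u * inl q = 1.
Proof.
move=> q0; exists (tensor_inl A (tofrac q : ratfun K n)^-1).
rewrite -rmorphM mulVf ?rmorph1 //.
by rewrite -[X in _ == X]tofrac0 tofrac_eq.
Qed.

Definition ideal_extension (N : set {mpoly A[n]}) : set T :=
  [set t | exists q f, [/\ q != 0, inl q * t = mpoly_to_tensor f & N f]].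

(** The residue map [r] of [N] is injective on K[X_1, ..., X_n], so it extends to the rational
    functions and, together with its restriction to A, to a map [h] on T. The extension of [N] is
    the kernel of [h], and it contracts to [N] because [h] induces [r]. *)
Lemma prime_extended (N : set {mpoly A[n]}) :
    prime_ideal N -> (forall p, N (scalars p) -> p = 0) ->
  prime_ideal (ideal_extension N) /\ mpoly_to_tensor @^-1` ideal_extension N = N.
Proof.
move=> pN disj; have [L [r Nr]] := residue_field pN.
have rS p : r (scalars p) = 0 -> p = 0.
  by move=> rp; apply: disj; rewrite Nr.
have [b bE] := @fraction_lift _ L (r \o scalars) rS.
pose b' : {rmorphism ratfun K n -> L} := b.
pose a : {rmorphism A -> L} := r \o @mpolyC n A.
have [|h [hl hr]] := @tensor_lift K (ratfun K n) A L b' a.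
  by move=> k; rewrite ratfun_scalar /b' bE /= scalarsC.
have hT f : h (mpoly_to_tensor f) = r f.
  apply: (@mpoly_rmorph_eq _ _ _ (h \o mpoly_to_tensor) r) => [c|i] /=.
    by rewrite mpoly_to_tensorC hr.
  by rewrite mpoly_to_tensorX hl /b' bE /= scalarsX.
have extE : ideal_extension N = [set t | h t = 0].
  apply/seteqP; split=> t /=.
    move=> [q [f [q0 e Nf]]]; move: Nf; rewrite Nr /= -hT -e rmorphM hl /b' bE /=.
    by move/eqP; rewrite mulf_eq0 => /orP[/eqP/rS/eqP|/eqP//]; rewrite (negPf q0).
  move=> ht; have [q [f [q0 e]]] := tensor_denominator t.
  by exists q, f; split=> //; rewrite Nr /= -hT -e rmorphM ht mulr0.
split; first by rewrite extE; apply: prime_kernel.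
by rewrite extE Nr; apply/funext => f /=; rewrite hT.
Qed.

End RationalTensor.

(** * Dimension *)

Section SupNat.
Implicit Types (S : set nat) (y : \bar int).

Lemma sup_nat_ge S d : S d -> ((d%:Z)%:E <= sup_nat S)%E.
Proof. by move=> Sd; apply: (sup_natP S).1; exists d. Qed.

Lemma sup_nat_le S y : (forall d, S d -> ((d%:Z)%:E <= y)%E) -> (sup_nat S <= y)%E.
Proof. by move=> Sy; apply: (sup_natP S).2 => _ [d Sd <-]; apply: Sy. Qed.

Lemma sup_nat_attained S n : ((n%:Z)%:E <= sup_nat S)%E ->
  exists2 d, S d & (n <= d)%N.
Proof.
move=> nS; apply: contrapT => nex.
(* The bound is an integer, equal to -1 for [n = 0], so that case also yields an element of [S]. *)
have : (sup_nat S <= (n%:Z - 1)%:E)%E.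
  apply: sup_nat_le => d Sd; rewrite lee_fin -ltzD1 subrK ltz_nat ltnNge.
  by apply/negP => nd; apply: nex; exists d.
move/(le_trans nS); rewrite lee_fin -ltzD1 subrK.
by rewrite ltxx.
Qed.

Lemma sup_nat_shift S S' n : (forall d, S d -> S' (d + n)%N) ->
  ((n%:Z)%:E + sup_nat S <= sup_nat S')%E.
Proof.
move=> SS'; rewrite -leeBrDl //; apply: sup_nat_le => d Sd.
by rewrite leeBrDr //; apply: (sup_nat_ge (SS' d Sd)).
Qed.

(** With truncated subtraction, [e <= n + (e - n)] holds even for [e < n]. *)
Lemma sup_nat_le_shift S S' n : (forall e, S' e -> S (e - n)%N) ->
  (sup_nat S' <= (n%:Z)%:E + sup_nat S)%E.
Proof.
move=> S'S; apply: sup_nat_le => e /S'S/sup_nat_ge Se.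
apply: le_trans (leeD2l _ Se); rewrite -EFinD lee_fin -PoszD lez_nat.
by rewrite -leq_subLR.
Qed.

End SupNat.

(** Every [y] is in the image up to a unit, so primes are determined by their preimages. This covers
    surjections, with [u = 1], and localizations. *)
Lemma prime_chain_preimage (R S : comPzRingType) (f : {rmorphism R -> S}) d F :
    (forall y, exists u x, (exists v, v * u = 1) /\ u * y = f x) ->
  prime_chain d F -> prime_chain d (fun i => f @^-1` F i).
Proof.
move=> frac [pF ltF]; split=> i id; first exact/prime_preimage/pF.
have [FF nFF] := ltF i id; have [idF _ _] := pF i (ltnW id).
split=> [x|FF']; first exact: FF.
apply: nFF => y Fy; have [u [x [[v vu] uy]]] := frac y.
have /FF' Fx : F i.+1 (f x) by rewrite -uy; apply: idealM => //; have [] := pF _ id.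
by rewrite -[y]mul1r -vu -mulrA uy; apply: idealM.
Qed.

(** The ring [{mpoly R[n.+1]}] is a quotient of the univariate polynomials over [{mpoly R[n]}], so
    each variable costs one step of the chain. Finite generation is carried along because
    [prime_chain_poly] requires it. *)
Lemma prime_chain_mpoly (R : comNzRingType) n : all_fin_gen R ->
  all_fin_gen {mpoly R[n]} /\
  forall d (F : nat -> set {mpoly R[n]}), prime_chain d F ->
    exists G : nat -> set R, prime_chain (d - n) G.
Proof.
move=> noeR; elim: n => [|n [noeRn IHn]].
  have surj p : exists a, (@mpolyC 0 R : {rmorphism R -> {mpoly R[0]}}) a = p.
    by apply: mpoly_surj => [a|[]//]; exists a.
  split; first exact: all_fin_gen_surj surj noeR.
  move=> d F cF; rewrite subn0.
  exists (fun i => (@mpolyC 0 R : {rmorphism R -> {mpoly R[0]}}) @^-1` F i).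
  apply: prime_chain_preimage => // y; have [x xy] := surj y.
  by exists 1, x; rewrite mul1r xy; split=> //; exists 1; rewrite mulr1.
pose h : {rmorphism {poly {mpoly R[n]}} -> {mpoly R[n.+1]}} :=
  horner_eval (polyvar R ord_max) \o map_poly (@mwiden n R).
have surj p : exists f, h f = p.
  apply: mpoly_surj => [a|i].
    exists (mpolyC n a)%:P.
    by rewrite /h /= map_polyC /horner_eval hornerC /= mwidenC.
  case: (unliftP ord_max i) => [j ->|->]; last first.
    by exists 'X; rewrite /h /= map_polyX /horner_eval hornerX.
  exists (polyvar R j)%:P.
  rewrite /h /= map_polyC /horner_eval hornerC /= mwidenX mnmwiden1.
  by congr (mpolyX _ (mnm1 _)); apply/val_inj; rewrite /= /bump leqNgt ltn_ord.
have noeP := hilbert_basis noeRn.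
split; first exact: all_fin_gen_surj surj noeP.
move=> d F cF.
have cP : prime_chain d (fun i => h @^-1` F i).
  apply: prime_chain_preimage => // y; have [x xy] := surj y.
  by exists 1, x; rewrite mul1r xy; split=> //; exists 1; rewrite mulr1.
have [G [cG _]] := prime_chain_poly noeP cP.
by rewrite subnS -subn1 subnAC subn1; apply: IHn cG.
Qed.

(** * Explicit chains of primes for the lower bound *)

Lemma prime_chain_cat (R : comPzRingType) d e (F G : nat -> set R) :
    prime_chain d F -> prime_chain e G -> F d = G 0%N ->
  exists H, [/\ prime_chain (d + e) H & H (d + e)%N = G e].
Proof.
move=> [pF ltF] [pG ltG] FG.
exists (fun i => if (i < d)%N then F i else G (i - d)%N); split; last first.
  by rewrite ltnNge leq_addr addKn.
split=> i ide.
  case: ltnP => [/ltnW/pF//|di]; apply: pG; by rewrite leq_subLR.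
case: (ltnP i d) => di; last first.
  by rewrite ltnNge (leqW di) /= subSn //; apply: ltG; rewrite ltn_subLR.
case: (ltnP i.+1 d) => [/ltnW/ltF//|di1].
have <- : i.+1 = d by apply/eqP; rewrite eqn_leq di.
rewrite subnn; have -> : G 0%N = F i.+1; last by apply: ltF.
by rewrite -FG; congr F; apply/eqP; rewrite eqn_leq di di1.
Qed.

Definition coefs_set (R : comNzRingType) n (P : set R) : set {mpoly R[n]} :=
  [set f | forall m, P (mcoeff m f)].
Arguments coefs_set {R} n P.

Lemma coefs_set_kernel (R S : comNzRingType) n (h : {rmorphism R -> S}) :
  coefs_set n [set x | h x = 0] = [set f | map_mpoly h f = 0].
Proof.
apply/seteqP; split=> f /=.
  by move=> hf; apply/mpolyP => m; rewrite mcoeff_map_mpoly mcoeff0; apply: hf.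
by move=> hf m /=; rewrite -mcoeff_map_mpoly hf mcoeff0.
Qed.

Lemma prime_chain_coefs (R : comNzRingType) n d (F : nat -> set R) :
  prime_chain d F -> prime_chain d (fun i => coefs_set n (F i)).
Proof.
move=> [pF ltF]; split=> i id.
  have [L [h ->]] := residue_field (pF i id).
  rewrite coefs_set_kernel.
  exact: (prime_kernel (map_mpoly h : {rmorphism {mpoly R[n]} -> {mpoly L[n]}})).
have [FF nFF] := ltF i id; split=> [f Ff m|]; first exact: FF.
apply: contra_not nFF => FF' a Fa.
have /FF'/(_ (@mnm0 n)) : coefs_set n (F i.+1) (mpolyC n a).
  move=> m; rewrite mcoeffC mulrC; apply: idealM => //.
  by have [] := pF _ id.
by rewrite mcoeffC eqxx mulr1.
Qed.

Section Specializations.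
Variables (R : comNzRingType) (L : idomainType) (h : {rmorphism R -> L}).
Variables (n : nat) (t : 'I_n -> R).

Let var_image (j : nat) (i : 'I_n) : {mpoly L[n]} :=
  if (i < j)%N then mpolyC n (h (t i)) else polyvar L i.

Let hC : {rmorphism R -> {mpoly L[n]}} := @mpolyC n L \o h.

Definition specialize (j : nat) : {rmorphism {mpoly R[n]} -> {mpoly L[n]}} :=
  projT1 (cid (mpoly_rmorph_exists hC (var_image j))).

Lemma specializeC j a : specialize j (mpolyC n a) = mpolyC n (h a).
Proof. exact: (projT2 (cid (mpoly_rmorph_exists hC (var_image j)))).1. Qed.

Lemma specializeX j i : specialize j (polyvar R i) =
  if (i < j)%N then mpolyC n (h (t i)) else polyvar L i.
Proof. exact: (projT2 (cid (mpoly_rmorph_exists hC (var_image j)))).2. Qed.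

(** The map [specialize j.+1] is [specialize j] followed by the substitution of [h (t j)] for the
    variable of index [j]. *)
Lemma specialize_sub j :
  [set f | specialize j f = 0] `<=` [set f | specialize j.+1 f = 0].
Proof.
have [s [sC sX]] := mpoly_rmorph_exists (@mpolyC n L) (var_image j.+1).
move=> f /= f0; suff -> : specialize j.+1 f = s (specialize j f).
  by rewrite f0 rmorph0.
apply: (mpoly_rmorph_eq (g := s \o specialize j)) => [a|i] /=.
  by rewrite !specializeC sC.
rewrite !specializeX; case: (ltnP i j) => ij; last by rewrite sX.
by rewrite sC ltnS ltnW.
Qed.

Lemma prime_chain_specialize :
  prime_chain n (fun j => [set f | specialize j f = 0]).
Proof.
split=> [i _|j jn]; first exact: prime_kernel.
split; first exact: specialize_sub.
(* The inclusion is strict: X_i - t_i is killed by [specialize j.+1], but its image under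
   [specialize j] has coefficient 1 at X_i. *)
pose i := Ordinal jn.
move=> /(_ (polyvar R i - mpolyC n (t i))) /=.
rewrite !rmorphB /= !specializeC !specializeX /= ltnSn ltnn subrr => /(_ erefl).
move/(congr1 (mcoeff (mnm1 i))); rewrite mcoeffB mcoeffX eqxx mcoeffC mcoeff0.
have -> : (mnm1 i == (@mnm0 n)) = false.
  by apply/negP => /eqP/mnmP/(_ i); rewrite mnm1E eqxx mnm0E.
by rewrite mulr0 subr0 => /eqP; rewrite oner_eq0.
Qed.

(** This joins the two chains: the last extended prime P_d[X_1, ..., X_n] is the first
    specialization kernel. *)
Lemma specialize0 : [set f | specialize 0 f = 0] = coefs_set n [set x | h x = 0].
Proof.
rewrite coefs_set_kernel; apply/funext => f /=; congr (_ = 0).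
apply: (mpoly_rmorph_eq (g := map_mpoly h)) => [a|i].
  by rewrite specializeC /= map_mpolyC.
by rewrite specializeX /= map_mpolyX.
Qed.

End Specializations.

(** * The two inequalities *)

Section Main.
Variables (K : fieldType) (A : comAlgType K) (n : nat).

Lemma specialize_scalars (L : fieldType) (h : {rmorphism A -> L}) (t : 'I_n -> A) p :
  specialize h t n (scalars A n p) = mpolyC n (h (mmap (in_alg A) t p)).
Proof.
pose f : {rmorphism {mpoly K[n]} -> {mpoly L[n]}} := specialize h t n \o @scalars K A n.
pose e : {rmorphism {mpoly K[n]} -> A} := mmap (in_alg A) t.
pose g : {rmorphism {mpoly K[n]} -> {mpoly L[n]}} := @mpolyC n L \o (h \o e).
apply: (@mpoly_rmorph_eq K n _ f g) => [k|i] /=.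
  by rewrite scalarsC specializeC /e /= mmapC.
by rewrite scalarsX specializeX ltn_ord /e /= mmapX mmap1U.
Qed.

Lemma mmap_subfield (F : {pred A}) m (t : 'I_m -> A) (p : {mpoly K[m]}) :
  subfield_over F -> (forall i, t i \in F) -> mmap (in_alg A) t p \in F.
Proof.
move=> [[F1 FZ FM] _] tF.
have F0 : 0 \in F by have := FZ (-1) 1 1 F1 F1; rewrite scaleN1r addNr.
have FD x y : x \in F -> y \in F -> x + y \in F.
  by move=> Fx Fy; rewrite -[x]scale1r; apply: FZ.
rewrite /mmap; elim/big_ind: _ => // k _; rewrite mulr_algl.
rewrite -[_ *: _]addr0; apply: FZ => //.
rewrite /mmap1; elim/big_ind: _ => // i _.
by elim: (k i) => [|e IHe]; rewrite ?expr0 // exprS; apply: FM.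
Qed.

Lemma alg_independent_widen m d (md : (m <= d)%N) (v : 'I_d -> A) :
  alg_independent v -> alg_independent (v \o widen_ord md).
Proof.
move=> vI p p0.
have [r [rC rX]] := @mpoly_rmorph_exists K m _ (@mpolyC d K)
  (fun i => polyvar K (widen_ord md i)).
(* Sending the additional variables to 0 gives a left inverse of [r], so [r p = 0] forces
   [p = 0]. *)
have [s [sC sX]] := @mpoly_rmorph_exists K d _ (@mpolyC m K)
  (fun i => if insub (val i) is Some j then polyvar K (j : 'I_m) else 0).
have sr : s (r p) = p.
  apply: (@mpoly_rmorph_eq K m _ (s \o r) idfun) => [k|i] /=.
    by rewrite rC sC.
  by rewrite rX sX /= insubT //=; congr (mpolyX _ (mnm1 _)); apply/val_inj.
rewrite -sr (vI (r p)) ?rmorph0 // -[RHS]p0.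
pose e (j : nat) (w : 'I_j -> A) : {rmorphism {mpoly K[j]} -> A} := mmap (in_alg A) w.
apply: (@mpoly_rmorph_eq K m _ (e d v \o r) (e m (v \o widen_ord md))) => [k|i].
  by rewrite /e /= rC !mmapC.
by rewrite /e /= rX !mmapX !mmap1U.
Qed.

Lemma prime_chain_tensor_ge (F : {pred A}) (t : 'I_n -> A) d (P : nat -> set A) :
    subfield_over F -> (forall i, t i \in F) -> alg_independent t ->
    prime_chain d P ->
  exists Q : nat -> set (tensor K (ratfun K n) A), prime_chain (d + n) Q.
Proof.
move=> sF tF tI cP; have [L [h Ph]] := residue_field (cP.1 d (leqnn d)).
have [|N [cN Nn]] := prime_chain_cat (prime_chain_coefs n cP)
  (prime_chain_specialize h t).
  by rewrite specialize0 -Ph.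
(* Every prime of the chain lies in the last one, where membership means that [h] kills p(t). A
   nonzero p(t) would be a unit, being in the subfield, so p(t) = 0 and independence applies. *)
have disj i p : (i <= d + n)%N -> N i (scalars A n p) -> p = 0.
  move=> idn /(prime_chain_sub cN idn); rewrite Nn /= specialize_scalars.
  move/(congr1 (mcoeff (@mnm0 n))); rewrite mcoeffC eqxx mulr1 mcoeff0 => hp.
  apply: tI; apply: contrapT => /eqP p0.
  have [y _ py] := sF.2 _ (mmap_subfield p sF tF) p0.
  have := congr1 h py; rewrite rmorphM hp mul0r rmorph1 => /esym/eqP.
  by rewrite oner_eq0.
exists (fun i => ideal_extension (N i)); split=> i idn.
  by apply: (prime_extended (cN.1 i idn) _).1 => p; apply: disj.
have [NN nNN] := cN.2 i idn.
split=> [x [q [f [q0 e Nf]]]|EE]; first by exists q, f; split=> //; apply: NN.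
apply: nNN.
(* The extended primes contract back to those of [N], so an equality between extensions would
   descend. *)
have [_ <-] := prime_extended (cN.1 i (ltnW idn)) (fun p => disj i p (ltnW idn)).
have [_ <-] := prime_extended (cN.1 i.+1 idn) (fun p => disj i.+1 p idn).
by move=> f; apply: EE.
Qed.

Lemma prime_chain_tensor_le d (Q : nat -> set (tensor K (ratfun K n) A)) :
  noetherian A -> prime_chain d Q -> exists P : nat -> set A, prime_chain (d - n) P.
Proof.
move=> /noetherian_fin_gen noeA cQ.
have [_ dimA] := prime_chain_mpoly n noeA.
apply: dimA; apply: (prime_chain_preimage (f := @mpoly_to_tensor K A n)) cQ => t.
have [q [f [q0 e]]] := tensor_denominator t.
by exists (tensor_inl A (FracField.tofrac q : ratfun K n)), f; split=> //; apply: inl_unit.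
Qed.

End Main.

Theorem corollary2p3 (K : fieldType) (A : comAlgType K) (n : nat)
    (hF : exists F : {pred A},
        subfield_over F /\ ((n%:Z)%:E <= trdeg F)%E) :
  ((n%:Z)%:E + krull_dim A <= krull_dim (tensor K (ratfun K n) A))%E /\
  (noetherian A ->
    krull_dim (tensor K (ratfun K n) A) = ((n%:Z)%:E + krull_dim A)%E).
Proof.
have [F [sF /sup_nat_attained[d [v vF vI] nd]]] := hF.
have lower : ((n%:Z)%:E + krull_dim A <= krull_dim (tensor K (ratfun K n) A))%E.
  apply: sup_nat_shift => e [P cP].
  have tF i : (v \o widen_ord nd) i \in F by apply: vF.
  exact: (prime_chain_tensor_ge sF tF (alg_independent_widen (md := nd) vI) cP).
split=> // noeA; apply/eqP; rewrite eq_le lower andbT.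
apply: sup_nat_le_shift => e [Q cQ]; exact: prime_chain_tensor_le cQ.
Qed.
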